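(* Let $\Omega\subset\mathbb{R}^N$ be a bounded Lipschitz domain, $s\in(0,1)$, and let $f\in L^r(\Omega)$ for some $r>1$. If $f(x)>0$ in $\Omega$, then there exists a unique maximizer of the problem $$\max_{\psi\in Y}\int_{\Omega}f\psi\,dx,$$ and it is given by $$u_\infty(x)=\begin{cases}(d(x,\partial\Omega))^s&\text{if }x\in\Omega,\\0&\text{if }x\in\mathbb{R}^N\setminus\Omega,\end{cases}$$ where $d(x,\partial\Omega)=\inf_{y\in\partial\Omega}|x-y|$.
   Context: $Y$ is the set of $\phi\in C^{0,s}(\mathbb{R}^N)$ with $\phi=0$ in $\mathbb{R}^N\setminus\Omega$ and $\sup_{x,y\in\mathbb{R}^N,\,x\ne y}\frac{|\phi(x)-\phi(y)|}{|x-y|^s}\le1$. *)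

(* Defs.v *)
From HB Require Import structures.
From mathcomp Require Import all_boot all_order all_algebra.
From mathcomp Require Import all_classical all_reals all_analysis.

Set Implicit Arguments.
Unset Strict Implicit.
Unset Printing Implicit Defensive.
Import Order.TTheory GRing.Theory Num.Theory.
Import numFieldNormedType.Exports.

Local Open Scope classical_set_scope.
Local Open Scope ring_scope.

(* R^N, for N >= 1, is 'rV[R]_n.+1 with N = n.+1.  The library norm on row
   vectors is the max norm: it is used only through the topology and
   boundedness, which do not depend on the norm.  Distances, Hoelder quotients
   and Lipschitz constants use the Euclidean norm below. *)

Definition enorm (R : realType) (m : nat) (x : 'rV[R]_m) : R :=
  Num.sqrt (\sum_(i < m) x 0 i ^+ 2).

(* Lebesgue measure on R^N, defined as usual: the outer measure obtained from
   countable coverings by half-open boxes, restricted to its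
   Caratheodory-measurable sets. *)

Definition box (R : realType) (n : nat) (ab : 'rV[R]_n.+1 * 'rV[R]_n.+1) :
    set 'rV[R]_n.+1 :=
  [set x | forall i, ab.1 0 i < x 0 i <= ab.2 0 i].

Definition box_volume (R : realType) (n : nat)
    (ab : 'rV[R]_n.+1 * 'rV[R]_n.+1) : R :=
  \prod_(i < n.+1) Num.max 0 (ab.2 0 i - ab.1 0 i).

Definition box_cover (R : realType) (n : nat) (A : set 'rV[R]_n.+1) :
    set (nat -> 'rV[R]_n.+1 * 'rV[R]_n.+1) :=
  [set B | A `<=` \bigcup_k box (B k)].

Definition lebesgue_outer (R : realType) (n : nat) (A : set 'rV[R]_n.+1) :
    \bar R :=
  ereal_inf [set (\sum_(k <oo) (box_volume (B k))%:E)%E | B in box_cover A].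

Section lebesgue_outer_measure.
Local Open Scope ereal_scope.
Variables (R : realType) (n : nat).
Implicit Types A B : set 'rV[R]_n.+1.

Let vol (ab : 'rV[R]_n.+1 * 'rV[R]_n.+1) : \bar R := (box_volume ab)%:E.

Let vol_ge0 ab : 0 <= vol ab.
Proof. by rewrite lee_fin; apply: prodr_ge0 => i _; rewrite le_max lexx. Qed.

Lemma lebesgue_outer_ge0 A : 0 <= lebesgue_outer A.
Proof.
by apply: le_ereal_inf_tmp => x [B _ <-{x}]; apply: nneseries_ge0 => k *;
  exact: vol_ge0.
Qed.

Lemma le_lebesgue_outer : {homo @lebesgue_outer R n : A B / A `<=` B >-> A <= B}.
Proof.
move=> A B AB; apply/ereal_inf_le_tmp => x [C BC <-{x}]; exists C => //.
exact: subset_trans AB BC.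
Qed.

Lemma lebesgue_outer0 : @lebesgue_outer R n set0 = 0.
Proof.
apply/eqP; rewrite eq_le lebesgue_outer_ge0 andbT.
apply: ereal_inf_lbound; exists (fun=> (0, 0)%R); first exact: sub0set.
apply: eseries0 => k _ _; congr EFin.
by rewrite /box_volume (bigD1 ord0)//= subrr maxxx mul0r.
Qed.

Lemma lebesgue_outer_sigma_subadditive : sigma_subadditive (@lebesgue_outer R n).
Proof.
move=> A; have [[i ioo]|] := pselect (exists i, lebesgue_outer (A i) = +oo).
  rewrite (eseries_pinfty _ _ ioo) ?leey// => k _.
  by rewrite -ltNye (lt_le_trans _ (lebesgue_outer_ge0 _)).
rewrite -forallNE => Aoo.
suff add2e (e : {posnum R}) : lebesgue_outer (\bigcup_k A k) <=
    \sum_(i <oo) lebesgue_outer (A i) + e%:num%:E.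
  by apply/lee_addgt0Pr => _/posnumP[].
rewrite (le_trans _ (epsilon_trick _ _ _))//; last first.
  by move=> k; exact: lebesgue_outer_ge0.
pose P k (B : nat -> 'rV[R]_n.+1 * 'rV[R]_n.+1) := box_cover (A k) B /\
  \sum_(j <oo) vol (B j) <= lebesgue_outer (A k) + (e%:num / (2 ^ k.+1)%:R)%:E.
have [G PG] : {G & forall k, P k (G k)}.
  apply: (@choice _ _ P) => k; rewrite /P /lebesgue_outer.
  set S := (X in ereal_inf X); move infS : (ereal_inf S) => iS.
  case: iS infS => [r Sr|Soo|Soo].
  - have en1 : (0 < e%:num / (2 ^ k.+1)%:R)%R by [].
    have /(lb_ereal_inf_adherent en1) : ereal_inf S \is a fin_num by rewrite Sr.
    move=> [x [B AB Bx] xS].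
    by exists B; split => //; rewrite Bx -Sr; exact/ltW.
  - by have := Aoo k; rewrite /lebesgue_outer Soo.
  - suff : lbound S 0 by move/le_ereal_inf_tmp; rewrite Soo.
    by move=> /= _ [B AB <-]; apply: nneseries_ge0 => *; exact: vol_ge0.
have volG_ge0 x : 0 <= (vol \o uncurry G) x by exact: vol_ge0.
apply: (@le_trans _ _ (\esum_(i in setT) (vol \o uncurry G) i)).
  rewrite /lebesgue_outer; apply: ereal_inf_lbound => /=.
  have /card_esym/ppcard_eqP[f] := card_nat2.
  exists (uncurry G \o f).
    move=> t [i _ /(PG i).1[j _ Bijt]]; exists (f^-1%FUN (i, j)) => //=.
    by rewrite invK ?inE.
  rewrite -(esum_pred_image (vol \o uncurry G) _ xpredT) ?[fun=> _]set_true//.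
  by rewrite image_eq.
rewrite (_ : esum _ _ = \sum_(i <oo) \sum_(j <oo) vol (G i j)); last first.
  pose J : nat -> set (nat * nat) := fun i => [set (i, j) | j in setT].
  rewrite (_ : setT = \bigcup_k J k); last first.
    by rewrite predeqE => -[a b]; split => // _; exists a => //; exists b.
  rewrite esum_bigcupT /=; last 2 first.
    - apply/trivIsetP => i j _ _ ij.
      rewrite predeqE => -[l m] /=; split => //= -[] [_] _ [<-{l} _].
      by move=> [m' _] [] /esym/eqP; rewrite (negbTE ij).
    - by move=> /= [l m]; exact: vol_ge0.
  rewrite -(image_id [set: nat]) -fun_true esum_pred_image//; last first.
    by move=> l _; exact: esum_ge0.
  apply: eq_eseriesr => /= j _.
  rewrite -(esum_pred_image (vol \o uncurry G) (pair j) predT)//=; last first.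
    by move=> ? ? _ _; exact: (@can_inj _ _ _ snd).
  by congr esum; rewrite predeqE => -[a b]; split; move=> [i _ <-]; exists i.
apply: lee_lim.
- apply: is_cvg_nneseries => l *.
  by apply: nneseries_ge0 => m *; exact: (volG_ge0 (l, m)).
- apply: is_cvg_nneseries => l *; apply: adde_ge0 => //.
  exact: lebesgue_outer_ge0.
- by near=> l; apply: lee_sum => i _; exact: (PG i).2.
Unshelve. all: by end_near. Qed.

HB.instance Definition _ := isOuterMeasure.Build R _ (@lebesgue_outer R n)
  lebesgue_outer0 lebesgue_outer_ge0 le_lebesgue_outer
  lebesgue_outer_sigma_subadditive.

End lebesgue_outer_measure.

Definition lebesgue_om (R : realType) (n : nat) :
  {outer_measure set 'rV[R]_n.+1 -> \bar R} := @lebesgue_outer R n.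

(* R^N with the sigma-algebra of Lebesgue-measurable sets; the carrier is
   convertible to 'rV[R]_n.+1. *)
Notation leb_space R n := (caratheodory_type (lebesgue_om R n)).

Definition leb (R : realType) (n : nat) :
    {measure set (leb_space R n) -> \bar R} :=
  (lebesgue_om R n : set (leb_space R n) -> \bar R).

Definition boundary (T : topologicalType) (A : set T) : set T :=
  closure A `\` interior A.

(* Near each boundary point, in some orthonormal coordinate system
   y = x *m Q, the set is the strict epigraph y_N > g(y_1, ..., y_(N-1)) of a
   Lipschitz function g. *)
Definition lipschitz_boundary (R : realType) (n : nat)
    (Omega : set 'rV[R]_n.+1) : Prop :=
  forall x0, boundary Omega x0 ->
  exists (Q : 'M[R]_n.+1) (rho L : R) (g : 'rV[R]_n -> R),
    [/\ Q *m Q^T = 1%:M,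
        0 < rho,
        (forall u v, `|g u - g v| <= L * enorm (u - v)) &
        forall x, enorm (x - x0) < rho ->
          (Omega x <->
           g (col' ord_max (x *m Q)) < (x *m Q) 0 ord_max)].

Definition bounded_lipschitz_domain (R : realType) (n : nat)
    (Omega : set 'rV[R]_n.+1) : Prop :=
  [/\ Omega !=set0, open Omega, connected Omega, bounded_set Omega &
      lipschitz_boundary Omega].

(* L^r(Omega): functions on Omega are represented by functions on R^N, of
   which only the values on Omega matter (f \_ Omega vanishes outside Omega). *)
Definition Lr_on (R : realType) (n : nat) (Omega : set 'rV[R]_n.+1) (r : R)
    (f : 'rV[R]_n.+1 -> R) : Prop :=
  (f \_ Omega : leb_space R n -> R) \in Lfun (leb R n) r%:E.

Definition holder_seminorm (R : realType) (n : nat) (s : R)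
    (phi : 'rV[R]_n.+1 -> R) : \bar R :=
  ereal_sup [set (`|phi p.1 - phi p.2| / enorm (p.1 - p.2) `^ s)%:E
            | p in [set p : 'rV[R]_n.+1 * 'rV[R]_n.+1 | p.1 != p.2]].

Definition holder_space (R : realType) (n : nat) (s : R) :
    set ('rV[R]_n.+1 -> R) :=
  [set phi | [bounded phi x | x in setT] /\ (holder_seminorm s phi < +oo)%E].

Definition Y (R : realType) (n : nat) (Omega : set 'rV[R]_n.+1) (s : R) :
    set ('rV[R]_n.+1 -> R) :=
  [set phi | [/\ holder_space s phi,
                 forall x, ~ Omega x -> phi x = 0 &
                 (holder_seminorm s phi <= 1)%E]].

Definition objective (R : realType) (n : nat) (Omega : set 'rV[R]_n.+1)
    (f psi : 'rV[R]_n.+1 -> R) : \bar R :=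
  (\int[leb R n]_(x in Omega) (f x * psi x)%:E)%E.

Definition maximizer (R : realType) (n : nat) (Omega : set 'rV[R]_n.+1) (s : R)
    (f : 'rV[R]_n.+1 -> R) : set ('rV[R]_n.+1 -> R) :=
  [set u | Y Omega s u /\
    forall psi, Y Omega s psi ->
      (objective Omega f psi <= objective Omega f u)%E].

Definition dist_boundary (R : realType) (n : nat) (Omega : set 'rV[R]_n.+1)
    (x : 'rV[R]_n.+1) : R :=
  inf [set enorm (x - y) | y in boundary Omega].

Definition u_infty (R : realType) (n : nat) (Omega : set 'rV[R]_n.+1) (s : R)
    (x : 'rV[R]_n.+1) : R :=
  if x \in Omega then dist_boundary Omega x `^ s else 0.

(* Main.v *)
(** Every psi in Y vanishes on the boundary, so the Hoelder bound gives
    psi <= d^s on Omega, while d^s extended by 0 lies in Y because t |-> t^s is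
    subadditive and every segment leaving Omega crosses the boundary.  Hence
    f psi <= f d^s almost everywhere, and equality of the integrals forces
    psi = d^s almost everywhere on Omega, so everywhere by continuity: a
    nonempty open set is not Lebesgue-null.  The last point, for the outer
    measure, is that countably many boxes covering a box have at least its
    volume. *)

Require Import Defs.
From mathcomp Require Import all_boot all_order all_algebra.
From mathcomp Require Import all_classical all_reals all_analysis.
From mathcomp Require Import measurable_realfun.
From mathcomp Require Import ring lra.
Import Order.TTheory GRing.Theory Num.Theory.
Import numFieldNormedType.Exports.
Local Open Scope classical_set_scope.
Local Open Scope ring_scope.

(** * The Euclidean norm and its comparison with the max norm *)

Lemma enorm_ge0 {R : realType} {m : nat} (x : 'rV[R]_m) : 0 <= enorm x.
Proof. exact: sqrtr_ge0. Qed.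

Lemma enorm_sqr {R : realType} {m : nat} (x : 'rV[R]_m) :
  enorm x ^+ 2 = \sum_(i < m) x 0 i ^+ 2.
Proof. by rewrite sqr_sqrtr// sumr_ge0// => i _; exact: sqr_ge0. Qed.

Lemma coord_le_enorm {R : realType} {m : nat} (x : 'rV[R]_m) i :
  `|x 0 i| <= enorm x.
Proof.
rewrite -ler_sqr ?nnegrE ?enorm_ge0// enorm_sqr real_normK ?num_real//.
by rewrite (bigD1 i)//= lerDl sumr_ge0// => j _; exact: sqr_ge0.
Qed.

Lemma enorm_gt0 {R : realType} {m : nat} (x : 'rV[R]_m) :
  (0 < enorm x) = (x != 0).
Proof.
apply/idP/idP => [|x0].
  apply: contraTneq => ->; rewrite -leNgt /enorm big1 ?sqrtr0// => i _.
  by rewrite mxE expr0n.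
rewrite lt_neqAle enorm_ge0 andbT eq_sym; apply: contraNneq x0 => x0.
apply/eqP/rowP => i; rewrite mxE; apply/eqP.
by rewrite -normr_le0 (le_trans (coord_le_enorm _ _))// x0.
Qed.

Lemma enorm0 {R : realType} {m : nat} : enorm (0 : 'rV[R]_m) = 0.
Proof. by apply/eqP; rewrite eq_le enorm_ge0 andbT leNgt enorm_gt0 eqxx. Qed.

Lemma enormZ {R : realType} {m : nat} (a : R) (x : 'rV[R]_m) :
  enorm (a *: x) = `|a| * enorm x.
Proof.
rewrite /enorm; under eq_bigr do rewrite mxE exprMn.
by rewrite -mulr_sumr sqrtrM ?sqr_ge0// sqrtr_sqr.
Qed.

Lemma enormC {R : realType} {m : nat} (x y : 'rV[R]_m) :
  enorm (x - y) = enorm (y - x).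
Proof. by rewrite -opprB -scaleN1r enormZ normrN1 mul1r. Qed.

(** For nonzero [x] and [y], expand the sum of squares of the coordinates of [|y| x - |x| y]: it
    equals [2 |x| |y| (|x| |y| - S)], where [S] is the inner product. *)
Lemma cauchy_schwarz_enorm {R : realType} {m : nat} (x y : 'rV[R]_m) :
  \sum_(i < m) x 0 i * y 0 i <= enorm x * enorm y.
Proof.
have [->|x0] := eqVneq x 0.
  by rewrite enorm0 mul0r big1// => i _; rewrite mxE mul0r.
have [->|y0] := eqVneq y 0.
  by rewrite enorm0 mulr0 big1// => i _; rewrite mxE mulr0.
move: x0 y0; rewrite -!enorm_gt0 => x0 y0.
set S := \sum_(i < m) _.
have : 0 <= \sum_(i < m) (enorm y * x 0 i - enorm x * y 0 i) ^+ 2.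
  by rewrite sumr_ge0// => i _; exact: sqr_ge0.
have -> : \sum_(i < m) (enorm y * x 0 i - enorm x * y 0 i) ^+ 2 =
    2 * (enorm x * enorm y) * (enorm x * enorm y - S).
  rewrite (eq_bigr (fun i => enorm y ^+ 2 * x 0 i ^+ 2 +
      enorm x ^+ 2 * y 0 i ^+ 2 - 2 * (enorm x * enorm y) * (x 0 i * y 0 i))).
    by rewrite sumrB big_split/= -!mulr_sumr -!enorm_sqr -/S; ring.
  by move=> i _; ring.
by rewrite pmulr_rge0 ?mulr_gt0// subr_ge0.
Qed.

Lemma enorm_triangle {R : realType} {m : nat} (x y : 'rV[R]_m) :
  enorm (x + y) <= enorm x + enorm y.
Proof.
rewrite -ler_sqr ?nnegrE ?addr_ge0 ?enorm_ge0// enorm_sqr.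
rewrite (eq_bigr (fun i =>
    x 0 i ^+ 2 + y 0 i ^+ 2 + 2 * (x 0 i * y 0 i))); last first.
  by move=> i _; rewrite mxE; ring.
rewrite !big_split/= -mulr_sumr -!enorm_sqr.
have := cauchy_schwarz_enorm x y; lra.
Qed.

Lemma coord_le_norm {R : realType} {m : nat} (x : 'rV[R]_m) i :
  `|x 0 i| <= `|x|.
Proof.
rewrite -[leRHS]/(mx_norm x) mx_normrE.
exact: (le_bigmax _ (fun ij : 'I_1 * 'I_m => `|x ij.1 ij.2|) (0, i)).
Qed.

Lemma enorm_le_norm {R : realType} {m : nat} (x : 'rV[R]_m) :
  enorm x <= m%:R * `|x|.
Proof.
rewrite -ler_sqr ?nnegrE ?mulr_ge0 ?enorm_ge0// enorm_sqr.
apply: (@le_trans _ _ (\sum_(i < m) `|x| ^+ 2)).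
  apply: ler_sum => i _.
  by rewrite -[leLHS]real_normK ?num_real// ler_sqr ?nnegrE ?coord_le_norm.
rewrite sumr_const card_ord -[leLHS]mulr_natl exprMn ler_wpM2r ?sqr_ge0//.
(* The sum of squares gives the factor [m], and [m <= m ^ 2]; the sharp constant [sqrt m] is not
   pursued. *)
by rewrite -natrX ler_nat; case: m {x} => // m; rewrite -mulnn leq_pmulr.
Qed.

(** * Powers with exponent [s] and the pointwise Hoelder bound *)

Lemma powRD_le {R : realType} (s a b : R) :
  0 < s -> s <= 1 -> 0 <= a -> 0 <= b ->
  (a + b) `^ s <= a `^ s + b `^ s.
Proof.
move=> s0 s1 a0 b0.
have [->|an0] := eqVneq a 0; first by rewrite add0r powR0 ?gt_eqF// add0r.
have [->|bn0] := eqVneq b 0; first by rewrite addr0 powR0 ?gt_eqF// addr0.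
have ap : 0 < a by rewrite lt_def an0.
have bp : 0 < b by rewrite lt_def bn0.
have ab : 0 < a + b by rewrite addr_gt0.
(* Since [t <= t ^ s] on []0, 1]], take [t = c / (a + b)]; the cases [c = a] and [c = b] add up to
   the claim. *)
have H c : 0 < c -> c <= a + b -> (a + b) `^ s * (c / (a + b)) <= c `^ s.
  move=> c0 cab; rewrite -[in leRHS](divfK (lt0r_neq0 ab) c) mulrC.
  rewrite powRM ?divr_ge0 ?(ltW c0) ?(ltW ab)// ler_wpM2r ?powR_ge0//.
  by rewrite ger1_powR// divr_gt0//= ler_pdivrMr// mul1r.
have := H a ap; have := H b bp.
rewrite lerDl b0 lerDr a0 => /(_ isT) hb /(_ isT) ha.
have -> : (a + b) `^ s =
    (a + b) `^ s * (a / (a + b)) + (a + b) `^ s * (b / (a + b)).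
  by rewrite -mulrDr -mulrDl divff ?mulr1// gt_eqF.
exact: lerD.
Qed.

Lemma holder_seminorm_le1P {R : realType} {n : nat} (s : R)
    (phi : 'rV[R]_n.+1 -> R) :
  (holder_seminorm s phi <= 1)%E <->
  forall x y, `|phi x - phi y| <= enorm (x - y) `^ s.
Proof.
split=> [h x y|h].
  have [->|xy] := eqVneq x y; first by rewrite subrr normr0 powR_ge0.
  have e0 : 0 < enorm (x - y) by rewrite enorm_gt0 subr_eq0.
  rewrite -[leRHS]mul1r -ler_pdivrMr ?powR_gt0// -lee_fin.
  apply: le_trans h; apply: ereal_sup_ubound.
  by exists (x, y).
apply: ge_ereal_sup => _ [[x y]/= xy <-]; rewrite lee_fin.
by rewrite ler_pdivrMr ?mul1r ?h// powR_gt0// enorm_gt0 subr_eq0.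
Qed.

(** * Boundary crossing and the distance to the boundary *)

(** If the segment from [x] to [y] missed the boundary, the parameters in [[0, 1]] sent into [Omega]
    would form a nonempty set both relatively open and relatively closed, hence all of [[0, 1]],
    against [~ Omega y]. *)
Lemma segment_meets_boundary {R : realType} {n : nat} {Omega : set 'rV[R]_n.+1}
    {x y : 'rV[R]_n.+1} : open Omega -> Omega x -> ~ Omega y ->
  exists2 z, boundary Omega z & enorm (x - z) <= enorm (x - y).
Proof.
move=> oO Ox nOy.
pose g (t : R) : 'rV[R]_n.+1 := x + t *: (y - x).
have cg : continuous g.
  by move=> t; apply: cvgD; [exact: cvg_cst|exact: scalel_continuous].
have [[t /= t01 bgt]|nb] :=
  pselect (exists2 t, `[0, 1]%classic t & boundary Omega (g t)).
  exists (g t) => //; rewrite /g opprD addNKr -scalerN opprB enormZ.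
  move: t01; rewrite in_itv/= => /andP[t0 t1].
  by rewrite ger0_norm// ler_piMl// enorm_ge0.
have gE : `[0, 1] `&` g @^-1` Omega = `[0, 1] `&` g @^-1` (closure Omega).
  apply/seteqP; split=> t [t01 gt]; split => //; first exact: subset_closure.
  apply: contrapT => nO; apply: nb; exists t => //; split => //.
  by rewrite ((interior_id _).1 oO).
have E : `[0, 1] `&` g @^-1` Omega = `[0, 1]%classic.
  apply: (@segment_connected R 0 1).
  - by exists 0; split; rewrite /= ?in_itv/= ?lexx ?ler01// /g scale0r addr0.
  - by exists (g @^-1` Omega) => //; exact: open_comp.
  - exists (g @^-1` closure Omega) => //.
    by apply: preimage_closed => //; exact: closed_closure.
have : `[0, 1]%classic (1 : R) by rewrite /= in_itv/= ler01 lexx.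
by rewrite -E => -[_]; rewrite /= /g scale1r addrC subrK.
Qed.

Lemma bounded_set_proper {R : realType} {n : nat} {Omega : set 'rV[R]_n.+1} :
  bounded_set Omega -> exists y, ~ Omega y.
Proof.
(* [bounded_set] bounds the norm by every number above [M], such as [M + 1]; the constant vector
   [M + 2] violates this bound. *)
move=> [M [_ bM]]; exists (const_mx (M + 2)) => Oc.
have := bM (M + 1); rewrite ltrDl => /(_ ltr01 _ Oc)/=.
apply/negP; rewrite -ltNge (lt_le_trans _ (coord_le_norm _ 0))//.
by rewrite mxE (lt_le_trans _ (ler_norm _))//; lra.
Qed.

Section distance.
Context {R : realType} {n : nat} {Omega : set 'rV[R]_n.+1}.
Hypotheses (oO : open Omega) (bO : bounded_set Omega) (O0 : Omega !=set0).
Implicit Types x y z : 'rV[R]_n.+1.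

(** Makes [dist_boundary] a genuine infimum: [inf] of the empty set would be a default value. *)
Lemma boundary_nonempty : boundary Omega !=set0.
Proof.
have [x Ox] := O0; have [y nOy] := bounded_set_proper bO.
by have [z bz _] := segment_meets_boundary oO Ox nOy; exists z.
Qed.

Lemma boundary_out z : boundary Omega z -> ~ Omega z.
Proof. by case=> _; rewrite ((interior_id _).1 oO). Qed.

Lemma dist_boundary_le x z : boundary Omega z ->
  dist_boundary Omega x <= enorm (x - z).
Proof.
move=> bz; apply: ge_inf; last by exists z.
by exists 0 => _ [w _ <-]; exact: enorm_ge0.
Qed.

Lemma le_dist_boundary x c :
  (forall z, boundary Omega z -> c <= enorm (x - z)) ->
  c <= dist_boundary Omega x.
Proof.
have [z bz] := boundary_nonempty.
move=> h; apply: lb_le_inf => [|_ [w bw <-]]; last exact: h.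
by exists (enorm (x - z)), z.
Qed.

Lemma dist_boundary_ge0 x : 0 <= dist_boundary Omega x.
Proof. by apply: le_dist_boundary => z _; exact: enorm_ge0. Qed.

Lemma dist_boundary_le_out x y : Omega x -> ~ Omega y ->
  dist_boundary Omega x <= enorm (x - y).
Proof.
move=> Ox Oy; have [z bz] := segment_meets_boundary oO Ox Oy.
by apply: le_trans; exact: dist_boundary_le.
Qed.

Lemma dist_boundary_lip x y :
  dist_boundary Omega x <= enorm (x - y) + dist_boundary Omega y.
Proof.
rewrite -lerBlDl; apply: le_dist_boundary => z bz; rewrite lerBlDl.
apply: le_trans (dist_boundary_le x z bz) _.
by have := enorm_triangle (x - y) (y - z); rewrite addrA subrK.
Qed.

Lemma Y_le_dist_boundary {s : R} {psi : 'rV[R]_n.+1 -> R} x : 0 < s ->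
  Y Omega s psi -> psi x <= dist_boundary Omega x `^ s.
Proof.
move=> s0 [_ psi0 /holder_seminorm_le1P psih].
rewrite (le_trans (ler_norm _))//.
(* Taking [s]-th roots reduces the claim to a bound by every [enorm (x - z)], so that the infimum is
   taken without the power. *)
have -> : `|psi x| = (`|psi x| `^ s^-1) `^ s.
  by rewrite -powRrM mulVf ?gt_eqF// powRr1.
rewrite ge0_ler_powR ?nnegrE ?powR_ge0 ?dist_boundary_ge0 ?(ltW s0)//.
apply: le_dist_boundary => z bz.
have -> : enorm (x - z) = (enorm (x - z) `^ s) `^ s^-1.
  by rewrite -powRrM mulfV ?gt_eqF// powRr1 ?enorm_ge0.
rewrite ge0_ler_powR ?nnegrE ?powR_ge0 ?invr_ge0 ?(ltW s0)//.
by have := psih x z; rewrite (psi0 _ (boundary_out _ bz)) subr0.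
Qed.

Lemma u_infty_in_Y {s : R} : 0 < s -> s <= 1 -> Y Omega s (u_infty Omega s).
Proof.
move=> s0 s1.
have uin x : Omega x -> u_infty Omega s x = dist_boundary Omega x `^ s.
  by move=> Ox; rewrite /u_infty mem_set.
have uout x : ~ Omega x -> u_infty Omega s x = 0.
  by move=> Ox; rewrite /u_infty memNset.
have u0 x : 0 <= u_infty Omega s x.
  by rewrite /u_infty; case: ifP; rewrite ?powR_ge0.
(* This one-sided estimate, used also with [x] and [y] exchanged, gives the seminorm bound; with [y]
   outside [Omega] it gives boundedness. *)
have H x y : u_infty Omega s x <= enorm (x - y) `^ s + u_infty Omega s y.
  have [Ox|Ox] := pselect (Omega x); last by rewrite uout// addr_ge0// powR_ge0.
  have [Oy|Oy] := pselect (Omega y).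
    rewrite !uin//; apply: le_trans (powRD_le _ _ _ s0 s1 _ _).
    - by rewrite ge0_ler_powR ?nnegrE ?addr_ge0 ?enorm_ge0 ?dist_boundary_ge0
        ?(ltW s0)// dist_boundary_lip.
    - exact: enorm_ge0.
    - exact: dist_boundary_ge0.
  rewrite (uout y)// addr0 uin// ge0_ler_powR ?nnegrE ?enorm_ge0
    ?dist_boundary_ge0 ?(ltW s0)//.
  exact: dist_boundary_le_out.
have semi : (holder_seminorm s (u_infty Omega s) <= 1)%E.
  apply/holder_seminorm_le1P => x y; rewrite ler_norml lerBlDr H andbT.
  by rewrite lerNl opprB lerBlDr enormC H.
split=> //; split; last by rewrite (le_lt_trans semi)// ltry.
have [y Oy] := bounded_set_proper bO.
have [M MO] : exists M, forall x, Omega x -> `|x| <= M.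
  by have [M [_ bM]] := bO; exists (M + 1) => x Ox; apply: bM; rewrite ?ltrDl.
exists ((n.+1%:R * (`|M| + `|y|)) `^ s); split=> [|c /ltW Mc x _ /=].
  exact: num_real.
apply: le_trans Mc.
rewrite ger0_norm//; have [Ox|Ox] := pselect (Omega x); last first.
  by rewrite uout ?powR_ge0.
apply: le_trans (H x y) _; rewrite (uout y)// addr0.
rewrite ge0_ler_powR ?nnegrE ?enorm_ge0 ?mulr_ge0 ?addr_ge0 ?(ltW s0)//.
apply: le_trans (enorm_le_norm _) _; rewrite ler_wpM2l//.
apply: le_trans (ler_normB _ _) _; rewrite lerD2r.
by rewrite (le_trans (MO _ Ox))// ler_norm.
Qed.

End distance.

(* Induction on the dimension: the slices at height [t] of the boxes that meet
   it cover the slice of the large box; integrate the induction hypothesis over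
   [t]. Selecting by [P] drops the other boxes, whose slices could not be made
   empty in dimension 0. *)
Lemma volume_le_cover {R : realType} {m : nat} (a b : 'I_m -> R) (P : pred nat)
    (A B : nat -> 'I_m -> R) :
  (forall i, a i < b i) ->
  (forall x : 'I_m -> R, (forall i, a i < x i <= b i) ->
    exists2 k, P k & forall i, A k i < x i <= B k i) ->
  ((\prod_i (b i - a i))%:E <=
    \sum_(k <oo | P k) (\prod_i Num.max 0 (B k i - A k i))%:E)%E.
Proof.
elim: m => [|m ih] in a b P A B *; move=> ab cov.
  (* In dimension 0 every product is 1, so one selected index is enough; covering the only point
     provides it. *)
  have [|k Pk _] := cov (fun=> 0); first by case.
  rewrite (@nneseriesD1 _ _ k)//; last by move=> j _; rewrite lee_fin big_ord0.
  by rewrite !big_ord0 leeDl// nneseries_ge0// => j _ _; rewrite lee_fin big_ord0.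
pose tl (f : 'I_m.+1 -> R) i := f (lift ord0 i).
pose v k : R := \prod_i Num.max 0 (tl (B k) i - tl (A k) i).
have v0 k : 0 <= v k by apply: prodr_ge0 => i _; rewrite le_max lexx.
pose I k : set R := `]A k ord0, B k ord0]%classic.
have slice t : `]a ord0, b ord0]%classic t ->
    ((\prod_i (tl b i - tl a i))%:E <=
     \sum_(k <oo) (if P k then (\1_(I k) t * v k)%:E else 0))%E.
  rewrite /= in_itv/= => abt.
  (* Only the boxes whose first side contains [t] have a slice at height [t]. *)
  pose Q := [pred k | P k && (A k ord0 < t <= B k ord0)].
  have : ((\prod_i (tl b i - tl a i))%:E <= \sum_(k <oo | Q k) (v k)%:E)%E.
    apply: ih => [i|x xab]; first exact: ab.
    (* The point with coordinate [t] at index 0 and the coordinates of [x] elsewhere. *)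
    have [|k Pk ABk] := cov (fun i => oapp x t (unlift ord0 i)).
      by move=> i /=; case: (unliftP ord0 i) => [j ->|->]; [exact: xab|exact: abt].
    exists k; first by rewrite inE Pk; have := ABk ord0; rewrite unlift_none.
    by move=> i; have := ABk (lift ord0 i); rewrite liftK.
  move/le_trans; apply; rewrite eseries_mkcond; apply: lee_nneseries => k.
    by move=> _ _; case: ifP => // _; rewrite lee_fin.
  move=> _; rewrite indicE mem_setE/= in_itv/=; case: (P k) => //=.
  by case: ifP; rewrite ?mul1r ?mul0r.
have mIk k : measurable (I k) by exact: measurable_itv.
have mI k : measurable_fun `]a ord0, b ord0]%classic
    ((fun t => (\1_(I k) t)%:E) : R -> \bar R).
  by apply/measurable_EFinP/measurable_indic; exact: mIk.
have f0 k t : (0 <= if P k then (\1_(I k) t * v k)%:E else 0)%E.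
  by case: ifP => // _; rewrite lee_fin mulr_ge0.
have mf k : measurable_fun `]a ord0, b ord0]%classic
    ((fun t => if P k then (\1_(I k) t * v k)%:E else 0%E) : R -> \bar R).
  case: (P k) => //=.
  exact: (emeasurable_funM (mI k) (measurable_cst (v k)%:E)).
have : (\int[lebesgue_measure]_(t in `]a ord0, b ord0])
      (\prod_i (tl b i - tl a i))%:E <=
    \int[lebesgue_measure]_(t in `]a ord0, b ord0])
      \sum_(k <oo) (if P k then (\1_(I k) t * v k)%:E else 0))%E.
  apply: ge0_le_integral => //.
  - move=> t _; rewrite lee_fin prodr_ge0// => i _.
    by rewrite subr_ge0 ltW// ab.
  - by apply: ge0_emeasurable_sum => [k t _ _|k _]; [exact: f0|exact: mf].
rewrite integral_cst//= lebesgue_measure_itv/= lte_fin ab -EFinB -EFinM.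
rewrite big_ord_recl/= mulrC => /le_trans; apply.
(* After exchanging sum and integral, the [k]-th term is [v k] times the length of the part of [I k]
   inside the first side of the large box. *)
rewrite integral_nneseries//.
rewrite [leRHS]eseries_mkcond; apply: lee_nneseries => k.
  by move=> _ _; apply: integral_ge0 => t _; exact: f0.
move=> _; case: ifP => [Pk|_]; last by rewrite integral0.
under eq_integral do rewrite EFinM.
rewrite ge0_integralZr//; [|exact: mI|by rewrite lee_fin].
rewrite integral_indic//; last exact: mIk.
rewrite big_ord_recl EFinM lee_wpmul2r ?lee_fin//.
apply: (@le_trans _ _ (lebesgue_measure (I k))).
  apply: le_measure; rewrite ?inE//; last exact: mIk.
  exact: (measurableI _ _ (mIk k) (measurable_itv _)).
rewrite lebesgue_measure_itv/= lte_fin; case: ifP => AB.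
  by rewrite -EFinB lee_fin le_max lexx orbT.
by rewrite lee_fin le_max lexx.
Qed.

(** * Measurability of open sets, and positivity of their measure *)

Section lebesgue_measurability.
Context {R : realType} {n : nat}.
Implicit Types (a b x : 'rV[R]_n.+1) (A : set 'rV[R]_n.+1).

Lemma box_volume_ge0 (ab : 'rV[R]_n.+1 * 'rV[R]_n.+1) : 0 <= box_volume ab.
Proof. by apply: prodr_ge0 => i _; rewrite le_max lexx. Qed.

(* [lo] and [hi] are the parts of the box in [x_i <= c] and in [x_i > c]. *)
Lemma box_volume_split (ab : 'rV[R]_n.+1 * 'rV[R]_n.+1) (i : 'I_n.+1) (c : R) :
  let lo := (ab.1, \row_j if j == i then Num.min (ab.2 0 j) c else ab.2 0 j) in
  let hi := (\row_j if j == i then Num.max (ab.1 0 j) c else ab.1 0 j, ab.2) in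
  box_volume ab = box_volume lo + box_volume hi.
Proof.
rewrite /box_volume/= (bigD1 i)//= [X in _ = X + _](bigD1 i)//=.
rewrite [X in _ = _ + X](bigD1 i)//= !mxE !eqxx.
rewrite [X in _ = _ * X + _](eq_bigr (fun j => Num.max 0 (ab.2 0 j - ab.1 0 j))) =>
    [|j ji]; last first.
  by rewrite !mxE (negbTE ji).
rewrite [X in _ = _ + _ * X](eq_bigr (fun j => Num.max 0 (ab.2 0 j - ab.1 0 j))) =>
    [|j ji]; last by rewrite !mxE (negbTE ji).
rewrite -mulrDl; congr (_ * _).
move: (ab.1 0 i) (ab.2 0 i) => u v.
(* What remains is the one-dimensional identity: cutting []u, v]] at [c] preserves total length,
   empty intervals counting as 0. *)
by case: (leP v c) => ?; case: (leP u c) => ?; case: (leP 0 (v - u)) => ?;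
  do ?[case: leP => ?]; lra.
Qed.

(** Caratheodory's criterion: cutting each box of a cover of [X] at [c] yields covers of the two
    parts of [X], and the volumes add up. *)
Lemma measurable_coord_le (i : 'I_n.+1) (c : R) :
  measurable ([set x | x 0 i <= c] : set (leb_space R n)).
Proof.
apply: le_caratheodory_measurable => X /=.
apply: le_ereal_inf_tmp => _ [B XB <-].
pose lo k : 'rV[R]_n.+1 * 'rV[R]_n.+1 :=
  ((B k).1, \row_j if j == i then Num.min ((B k).2 0 j) c else (B k).2 0 j).
pose hi k : 'rV[R]_n.+1 * 'rV[R]_n.+1 :=
  (\row_j if j == i then Num.max ((B k).1 0 j) c else (B k).1 0 j, (B k).2).
have -> : (\sum_(k <oo) (box_volume (B k))%:E)%E =
    (\sum_(k <oo) (box_volume (lo k))%:E + \sum_(k <oo) (box_volume (hi k))%:E)%E.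
  rewrite -nneseriesD; last 2 first.
  - by move=> k _ _; rewrite lee_fin box_volume_ge0.
  - by move=> k _ _; rewrite lee_fin box_volume_ge0.
  by apply: eq_eseriesr => k _; rewrite -EFinD -box_volume_split.
apply: leeD; apply: ereal_inf_lbound.
  exists lo => // x [Xx /= xc]; have [k _ Bk] := XB _ Xx; exists k => // j.
  rewrite /= mxE; have /andP[h1 h2] := Bk j; rewrite h1/=.
  by case: eqP => [->|//]; rewrite le_min xc andbT; have /andP[] := Bk i.
exists hi => // x [Xx /= /negP]; rewrite -ltNge => xc.
have [k _ Bk] := XB _ Xx; exists k => // j.
rewrite /= mxE; have /andP[h1 h2] := Bk j; rewrite h2 andbT.
by case: eqP => [->|//]; rewrite gt_max xc andbT; have /andP[] := Bk i.
Qed.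

Lemma measurable_box (ab : 'rV[R]_n.+1 * 'rV[R]_n.+1) :
  measurable (box ab : set (leb_space R n)).
Proof.
rewrite (_ : box ab = \bigcap_(i in [set: 'I_n.+1])
    ([set x | x 0 i <= ab.2 0 i] `\` [set x | x 0 i <= ab.1 0 i])).
  apply: fin_bigcap_measurable => [|i _]; first exact: finite_finset.
  by apply: measurableD; exact: measurable_coord_le.
apply/seteqP; split=> x h i /=.
  by move=> _; have /andP[? ?] := h i; split => //; apply/negP; rewrite -ltNge.
by have [/= ? /negP] := h i I; rewrite -ltNge => ->.
Qed.

(** Rational corners keep the family of boxes countable; the strict inequalities give the box
    positive volume. *)
Lemma open_box_nbhs A x : open A -> A x ->
  exists pq : 'rV[rat]_n.+1 * 'rV[rat]_n.+1,
    let ab := (map_mx ratr pq.1, map_mx ratr pq.2) in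
    [/\ forall i, ab.1 0 i < ab.2 0 i :> R, box ab x & box ab `<=` A].
Proof.
rewrite openE => /[apply] /nbhs_ballP[e /= e0 eA].
have rat_between (u v : R) : u < v -> exists q : rat, u < ratr q < v.
  by move=> /rat_in_itvoo[q]; rewrite in_itv/= => uqv; exists q.
have /choice[p hp] (i : 'I_n.+1) : exists q : rat, x 0 i - e < ratr q < x 0 i.
  by apply: rat_between; rewrite ltrBlDr ltrDl.
have /choice[q hq] (i : 'I_n.+1) : exists q : rat, x 0 i < ratr q < x 0 i + e.
  by apply: rat_between; rewrite ltrDl.
exists (\row_i p i, \row_i q i); split=> [i|i|y yab].
- by rewrite /= !mxE; have := hp i; have := hq i; lra.
- by rewrite /= !mxE; have := hp i; have := hq i; lra.
- apply: eA; split=> // k i; rewrite (ord1 k); have := yab i.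
  rewrite /= !mxE /ball/= => yi; have := hp i; have := hq i.
  rewrite ltr_norml; lra.
Qed.

Lemma open_lebesgue_measurable A : open A -> measurable (A : set (leb_space R n)).
Proof.
move=> oA; pose rbox (pq : 'rV[rat]_n.+1 * 'rV[rat]_n.+1) : set 'rV[R]_n.+1 :=
  box (map_mx ratr pq.1, map_mx ratr pq.2).
(* Boxes not contained in [A] are replaced by [set0], so that the union runs over the whole
   countable type of pairs. *)
rewrite (_ : A = \bigcup_pq if `[< rbox pq `<=` A >] then rbox pq else set0).
  apply: countable_bigcupT_measurable => // pq.
  by case: ifPn => _; [exact: measurable_box|exact: measurable0].
apply/seteqP; split=> [x Ax|x [pq _]].
  have [pq [_ bx bA]] := open_box_nbhs A x oA Ax.
  by exists pq => //; case: asboolP.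
by case: asboolP => // h; exact: h.
Qed.

Lemma continuous_lebesgue_measurable (f : 'rV[R]_n.+1 -> R) D :
  continuous f -> measurable (D : set (leb_space R n)) ->
  measurable_fun (D : set (leb_space R n)) (f : leb_space R n -> R).
Proof.
move=> cf mD.
apply: (measurability _ (RGenOInfty.measurableE R)) => //.
move=> _ [_ [c ->] <-]; apply: measurableI => //.
by apply: open_lebesgue_measurable; apply: open_comp => // x _; exact: cf.
Qed.

Lemma le_lebesgue_outer_box (ab : 'rV[R]_n.+1 * 'rV[R]_n.+1) :
  (forall i, ab.1 0 i < ab.2 0 i) ->
  ((\prod_(i < n.+1) (ab.2 0 i - ab.1 0 i))%:E <= lebesgue_outer (box ab))%E.
Proof.
move=> h; apply: le_ereal_inf_tmp => _ [B cB <-].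
apply: (@volume_le_cover _ _ (ab.1 0) (ab.2 0) xpredT
  (fun k => (B k).1 0) (fun k => (B k).2 0)) => // x xab.
have [|k _ Bk] := cB (\row_i x i); first by move=> i; rewrite mxE.
by exists k => // i; have := Bk i; rewrite mxE.
Qed.

(** A point of [A] would lie in a box inside [A], whose outer measure is at least its positive
    volume. *)
Lemma open_negligible A : open A -> (leb R n).-negligible A -> A = set0.
Proof.
move=> oA [N [mN N0 AN]]; apply/seteqP; split=> // x Ax.
have [pq [ab _ bA]] := open_box_nbhs A x oA Ax.
have := le_lebesgue_outer_box _ ab.
apply/negP; rewrite -ltNge; apply: (@le_lt_trans _ _ 0%E).
  rewrite -N0; apply: (le_outer_measure (lebesgue_om R n)).
  exact: subset_trans bA AN.
by rewrite lte_fin prodr_gt0// => i _; rewrite subr_gt0.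
Qed.

Lemma lebesgue_bounded_lty A : bounded_set A -> (leb R n A < +oo)%E.
Proof.
move=> [M [_ bM]].
(* Coordinates are at most [M + 1] in absolute value; [M + 2] makes the lower inequality of the
   half-open box strict. *)
pose c : 'rV[R]_n.+1 * 'rV[R]_n.+1 := (const_mx (- (M + 2)), const_mx (M + 2)).
apply: (@le_lt_trans _ _ (box_volume c)%:E); last exact: ltry.
(* One large cube, followed by degenerate boxes of volume 0. *)
pose B k : 'rV[R]_n.+1 * 'rV[R]_n.+1 := if k == 0%N then c else (0, 0).
have -> : (box_volume c)%:E = (\sum_(k <oo) (box_volume (B k))%:E)%E.
  rewrite (@nneseriesD1 _ _ 0%N)//; last first.
    by move=> k _; rewrite lee_fin box_volume_ge0.
  rewrite eseries0 ?adde0// => k _ /= k0; rewrite /B (negbTE k0).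
  by rewrite /box_volume (bigD1 ord0)//= subrr maxxx mul0r.
apply: ereal_inf_lbound; exists B => // x Ax; exists 0%N => // i.
have := bM (M + 1); rewrite ltrDl => /(_ ltr01 _ Ax)/= xM.
rewrite !mxE; have := le_trans (coord_le_norm x i) xM.
by rewrite ler_norml; lra.
Qed.

End lebesgue_measurability.

(** * Integrability of the competitors, optimality and uniqueness *)

Lemma Y_continuous {R : realType} {n : nat} {Omega : set 'rV[R]_n.+1} {s : R}
    {psi : 'rV[R]_n.+1 -> R} : 0 < s -> Y Omega s psi -> continuous psi.
Proof.
move=> s0 [_ _ /holder_seminorm_le1P psih] x.
apply/(cvgrPdist_lt (F := nbhs x)) => e e0.
(* This radius makes the Euclidean distance, at most [n.+1] times the max norm, smaller than
   [e ^ (1 / s)]. *)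
have d0 : 0 < e `^ s^-1 / n.+1%:R by rewrite divr_gt0 ?powR_gt0.
apply/nbhs_ballP; exists (e `^ s^-1 / n.+1%:R) => //= y.
rewrite mx_norm_ball/= => xy.
apply: le_lt_trans (psih x y) _.
have -> : e = (e `^ s^-1) `^ s by rewrite -powRrM mulVf ?gt_eqF// powRr1// ltW.
rewrite gt0_ltr_powR ?nnegrE ?enorm_ge0 ?powR_ge0//.
by apply: le_lt_trans (enorm_le_norm _) _; rewrite mulrC -ltr_pdivlMr.
Qed.

(* The library's hint does not see through the definition of [leb]. *)
#[local] Instance leb_ae_filter (R : realType) (n : nat) :
  Filter (nbhs (almost_everywhere (leb R n))).
Proof. exact: (ae_filter_ringOfSetsType (leb R n)). Qed.

Section objective.
Context {R : realType} {n : nat} {Omega : set 'rV[R]_n.+1} {s r : R}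
  {f : 'rV[R]_n.+1 -> R}.
Hypotheses (oO : open Omega) (bO : bounded_set Omega) (O0 : Omega !=set0).
Hypotheses (s0 : 0 < s) (s1 : s <= 1) (r1 : 1 <= r) (hf : Lr_on Omega r f).
Hypothesis fpos : {ae leb R n, forall x, Omega x -> 0 < f x}.

Let mO : measurable (Omega : set (leb_space R n)).
Proof. exact: open_lebesgue_measurable. Qed.

Lemma Lr_on_integrable :
  (leb R n).-integrable Omega (EFin \o (f : leb_space R n -> R)).
Proof.
have mf : measurable_fun (Omega : set (leb_space R n)) (f : leb_space R n -> R).
  by apply/(measurable_restrictT _ mO); move: hf => /sub_Lfun_mfun; rewrite inE.
(* The dominating function uses [|f| <= 1 + |f| ^ r]; the constant is integrable because [Omega] has
   finite measure. *)
apply: (le_integrable mO (g := fun x => (1 + `|(f \_ Omega) x| `^ r)%:E)).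
- exact/measurable_EFinP.
- move=> x Ox; rewrite /= lee_fin patchE mem_set//.
  rewrite [leRHS]ger0_norm ?addr_ge0 ?powR_ge0//.
  have [f1|/ltW f1] := leP `|f x| 1.
    by rewrite (le_trans f1)// lerDl powR_ge0.
  by rewrite (le_trans (le1r_powR f1 r1))// lerDr.
- under eq_fun do rewrite EFinD.
  apply: integrableD => //.
    apply: (measurable_bounded_integrable (f := cst 1)) => //.
      exact: lebesgue_bounded_lty.
    exact: bounded_cst.
  apply: (integrableS measurableT mO) => //.
  exact: (Lfun_integrable r1 hf).
Qed.

Lemma objective_integrable {psi} : Y Omega s psi ->
  (leb R n).-integrable Omega (fun x => (f x * psi x)%:E).
Proof.
move=> Ypsi; have [[bpsi _] _ _] := Ypsi.
apply: (integrableMl mO Lr_on_integrable (h := psi)).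
  by apply: continuous_lebesgue_measurable => //; exact: Y_continuous Ypsi.
by have [M [Mr Mp]] := bpsi; exists M; split => // c Mc x _; exact: Mp.
Qed.

(** Almost everywhere on [Omega], [f (u - psi)] is nonnegative and equals its absolute value.
    Writing the gain as the integral of an absolute value serves both optimality and uniqueness. *)
Lemma objective_u_infty {psi} : Y Omega s psi ->
  objective Omega f (u_infty Omega s) = (objective Omega f psi +
    \int[leb R n]_(x in Omega)
      `|(f x * u_infty Omega s x)%:E - (f x * psi x)%:E|)%E.
Proof.
move=> Ypsi.
have iu := objective_integrable (u_infty_in_Y oO bO O0 s0 s1).
have ipsi := objective_integrable Ypsi.
have fin : objective Omega f psi \is a fin_num by exact: integrable_fin_num.
rewrite [X in (_ + X)%E](_ : _ = objective Omega f (u_infty Omega s) -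
  objective Omega f psi)%E; first by rewrite addeC subeK.
rewrite -integralB//.
have mB : measurable_fun (Omega : set (leb_space R n))
    (fun x => (f x * u_infty Omega s x)%:E - (f x * psi x)%:E)%E.
  exact: measurable_int (integrableB mO iu ipsi).
apply: ae_eq_integral => //; first exact: measurableT_comp.
apply: filterS fpos => x fx Ox /=.
congr EFin; rewrite ger0_norm// -mulrBr mulr_ge0 ?(ltW (fx Ox))//.
by rewrite subr_ge0 /u_infty mem_set// Y_le_dist_boundary.
Qed.

Lemma u_infty_maximizer : maximizer Omega s f (u_infty Omega s).
Proof.
split=> [|psi Ypsi]; first exact: u_infty_in_Y.
by rewrite (objective_u_infty Ypsi) leeDl// integral_ge0.
Qed.

Lemma maximizer_unique v : maximizer Omega s f v -> v = u_infty Omega s.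
Proof.
move=> [Yv vmax]; have Yu := u_infty_in_Y oO bO O0 s0 s1.
have iu := objective_integrable Yu; have iv := objective_integrable Yv.
have fin : objective Omega f v \is a fin_num by exact: integrable_fin_num.
(* Cancelling the finite value at [v] leaves an integral of an absolute value that is at most 0, so
   its integrand vanishes almost everywhere. *)
have := vmax _ Yu; rewrite (objective_u_infty Yv) -[leRHS]adde0 leeD2lE//.
rewrite le_eqVlt => /predU1P[/ae_eq_integral_abs|]; last first.
  by rewrite ltNge integral_ge0.
move=> /(_ mO (measurable_int _ (integrableB mO iu iv))) uv.
pose w x := u_infty Omega s x - v x.
(* [D] is where [v] differs from [u_infty] inside [Omega]: open by continuity, and negligible
   because [f > 0] can be cancelled almost everywhere. *)
pose D := Omega `&` w @^-1` (~` [set 0]).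
have oD : open D.
  apply: openI => //; apply: open_comp => [x _|].
    exact: (cvgB (Y_continuous s0 Yu x) (Y_continuous s0 Yv x)).
  by rewrite openC; exact: closed_eq.
have D0 : D = set0.
  apply: open_negligible => //.
  have : {ae leb R n, forall x, ~ D x}.
    apply: filterS2 fpos uv => x fx uvx [Ox]; apply.
    have := uvx Ox; rewrite /= -EFinB => -[/eqP].
    by rewrite -mulrBr mulf_eq0 gt_eqF ?fx//= => /eqP.
  by apply: negligibleS => x Dx /=.
apply/funext => x; have [Ox|Ox] := pselect (Omega x).
  apply/eqP; rewrite eq_sym -subr_eq0; apply: contrapT => wx.
  have Dx : D x by split => // /eqP.
  by rewrite D0 in Dx.
by rewrite /u_infty memNset//; case: Yv => _ ->.
Qed.

End objective.

Theorem corollary5p5 (R : realType) (n : nat) (Omega : set 'rV[R]_n.+1)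
    (s r : R) (f : 'rV[R]_n.+1 -> R)
    (hOmega : bounded_lipschitz_domain Omega)
    (hs0 : 0 < s) (hs1 : s < 1) (hr : 1 < r)
    (hf : Lr_on Omega r f)
    (fpos : {ae leb R n, forall x, Omega x -> 0 < f x}) :
  maximizer Omega s f (u_infty Omega s) /\
  (forall v, maximizer Omega s f v -> v = u_infty Omega s).
Proof.
case: hOmega => O0 oO _ bO _; split.
  exact: (u_infty_maximizer oO bO O0 hs0 (ltW hs1) (ltW hr) hf fpos).
exact: (maximizer_unique oO bO O0 hs0 (ltW hs1) (ltW hr) hf fpos).
Qed.
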